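(* Let $\mathbb{F}$ be a field of characteristic $0$, let $n\ge 1$, and let $\Phi:\operatorname{GL}(n,\mathbb{F})\to \operatorname{GL}(n,\mathbb{F})$ be a multiplicative map which is non-trivial, i.e. $\operatorname{SL}(n,\mathbb{F})\not\subseteq \Phi^{-1}(I_n)$. Then there exist a multiplicative map $\lambda:\mathbb{F}^{\ast}\to\mathbb{F}^{\ast}$ and maps $\Phi_1,\Phi_2:\operatorname{GL}(n,\mathbb{F})\to\operatorname{GL}(n,\mathbb{F})$ such that $$\Phi(A)=\lambda(\det(\Phi_1(A)))\,\Phi_2(A)\qquad\text{for all }A\in \operatorname{GL}(n,\mathbb{F}),$$ where each of $\Phi_1,\Phi_2$ is a (finite) composition of multiplicative maps of the following types: (a) $\Phi_R(A)=R^{-1}AR$ for some invertible $n\times n$ matrix $R$ over $\mathbb{F}$; (b) $\Phi^{*}(A)=(A^{\ast})^{t}$, where $A^{\ast}$ is the adjugate matrix of $A$ (so that $AA^{\ast}=\det(A)I_n$) and ${}^{t}$ denotes transpose; (c) $\Phi_\varphi(A)=(\varphi(a_{ij}))$ for $A=(a_{ij})$, where $\varphi:\mathbb{F}\to\mathbb{F}$ is a ring homomorphism with $\varphi(1)=1$.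
   Context: A map $\Psi$ between multiplicative semigroups (such as $\operatorname{GL}(n,\mathbb{F})$ or $\mathbb{F}^{\ast}=\mathbb{F}\setminus\{0\}$) is called multiplicative if $\Psi(AB)=\Psi(A)\Psi(B)$ for all $A,B$; no linearity or continuity is assumed. $I_n$ is the $n\times n$ identity matrix. *)

(* Defs.v *)
From HB Require Import structures.
From mathcomp Require Import all_boot all_order all_algebra.

Set Implicit Arguments.
Unset Strict Implicit.
Unset Printing Implicit Defensive.

Import GRing.Theory.
Local Open Scope ring_scope.

(* MathComp's {'GL_n[R]} and {unit R} require a finite ring R, so GL(n, F) and
   F^* are set up here as subtypes with a groupType structure, for an arbitrary
   field F. *)

Record Fstar (F : fieldType) := MkFstar {
  Fstar_val : F;
  Fstar_neq0 : Fstar_val != 0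
}.

Record GL (n : nat) (F : fieldType) := MkGL {
  GLmx :> 'M[F]_n;
  GLmx_unit : GLmx \in unitmx
}.

Bind Scope group_scope with Fstar GL.

HB.instance Definition _ F := [isSub for @Fstar_val F].
HB.instance Definition _ F := [Choice of Fstar F by <:].
HB.instance Definition _ n F := [isSub for @GLmx n F].
HB.instance Definition _ n F := [Choice of GL n F by <:].

Section FstarGroup.

Variable F : fieldType.
Implicit Types a b c : Fstar F.

Fact Fstar_mul_subproof a b : val a * val b != 0.
Proof. by rewrite mulf_neq0 ?Fstar_neq0. Qed.

Fact Fstar_inv_subproof a : (val a)^-1 != 0.
Proof. by rewrite invr_eq0 Fstar_neq0. Qed.

Definition Fstar_one : Fstar F := MkFstar (oner_neq0 F).
Definition Fstar_mul a b : Fstar F := MkFstar (Fstar_mul_subproof a b).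
Definition Fstar_inv a : Fstar F := MkFstar (Fstar_inv_subproof a).

Fact Fstar_mulA : associative Fstar_mul.
Proof. by move=> a b c; apply: val_inj; rewrite /= mulrA. Qed.

Fact Fstar_mul1 : left_id Fstar_one Fstar_mul.
Proof. by move=> a; apply: val_inj; rewrite /= mul1r. Qed.

Fact Fstar_mulr1 : right_id Fstar_one Fstar_mul.
Proof. by move=> a; apply: val_inj; rewrite /= mulr1. Qed.

Fact Fstar_mulV : left_inverse Fstar_one Fstar_inv Fstar_mul.
Proof. by move=> a; apply: val_inj; rewrite /= mulVf ?Fstar_neq0. Qed.

Fact Fstar_mulrV : right_inverse Fstar_one Fstar_inv Fstar_mul.
Proof. by move=> a; apply: val_inj; rewrite /= mulfV ?Fstar_neq0. Qed.

HB.instance Definition _ := isGroup.Build (Fstar F)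
  Fstar_mulA Fstar_mul1 Fstar_mulr1 Fstar_mulV Fstar_mulrV.

End FstarGroup.

Section GLGroup.

Variables (n : nat) (F : fieldType).
Implicit Types A B C : GL n F.

Fact GL_one_subproof : (1%:M : 'M[F]_n) \in unitmx.
Proof. exact: unitmx1. Qed.

Fact GL_mul_subproof A B : A *m B \in unitmx.
Proof. by rewrite unitmx_mul !GLmx_unit. Qed.

Fact GL_inv_subproof A : invmx A \in unitmx.
Proof. by rewrite unitmx_inv GLmx_unit. Qed.

Definition GL_one : GL n F := MkGL GL_one_subproof.
Definition GL_mul A B : GL n F := MkGL (GL_mul_subproof A B).
Definition GL_inv A : GL n F := MkGL (GL_inv_subproof A).

Fact GL_mulA : associative GL_mul.
Proof. by move=> A B C; apply: val_inj; rewrite /= mulmxA. Qed.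

Fact GL_mul1 : left_id GL_one GL_mul.
Proof. by move=> A; apply: val_inj; rewrite /= mul1mx. Qed.

Fact GL_mulr1 : right_id GL_one GL_mul.
Proof. by move=> A; apply: val_inj; rewrite /= mulmx1. Qed.

Fact GL_mulV : left_inverse GL_one GL_inv GL_mul.
Proof. by move=> A; apply: val_inj; rewrite /= mulVmx ?GLmx_unit. Qed.

Fact GL_mulrV : right_inverse GL_one GL_inv GL_mul.
Proof. by move=> A; apply: val_inj; rewrite /= mulmxV ?GLmx_unit. Qed.

HB.instance Definition _ := isGroup.Build (GL n F)
  GL_mulA GL_mul1 GL_mulr1 GL_mulV GL_mulrV.

End GLGroup.

Definition SL (n : nat) (F : fieldType) : {pred GL n F} :=
  [pred A : GL n F | \det A == 1].

Arguments SL : clear implicits.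

Section GLMaps.

Variables (n : nat) (F : fieldType).
Implicit Types (A B R : GL n F) (a : Fstar F) (phi : {rmorphism F -> F}).

Fact detGL_subproof A : \det A != 0.
Proof. by rewrite -unitfE -unitmxE GLmx_unit. Qed.

Definition detGL A : Fstar F := MkFstar (detGL_subproof A).

Fact scaleGL_subproof a A : val a *: (A : 'M[F]_n) \in unitmx.
Proof. by rewrite unitmxZ ?GLmx_unit // unitfE Fstar_neq0. Qed.

Definition scaleGL a A : GL n F := MkGL (scaleGL_subproof a A).

Definition conjGL R A : GL n F := (R^-1 * A * R)%g.

Fact adjTGL_subproof A : (\adj A)^T \in unitmx.
Proof.
rewrite unitmx_tr.
have: A *m \adj A \in unitmx.
  by rewrite mul_mx_adj -scalemx1 unitmxZ ?unitmx1 // unitfE detGL_subproof.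
by rewrite unitmx_mul => /andP[].
Qed.

Definition adjTGL A : GL n F := MkGL (adjTGL_subproof A).

Fact mapGL_subproof phi A : map_mx phi A \in unitmx.
Proof. by rewrite map_unitmx GLmx_unit. Qed.

Definition mapGL phi A : GL n F := MkGL (mapGL_subproof phi A).

Fact detGL_is_multiplicative : {morph detGL : A B / (A * B)%g}.
Proof. by move=> A B; apply: val_inj; rewrite /= det_mulmx. Qed.

HB.instance Definition _ :=
  isMultiplicative.Build (GL n F) (Fstar F) detGL detGL_is_multiplicative.

Fact conjGL_is_multiplicative R : {morph conjGL R : A B / (A * B)%g}.
Proof. by move=> A B; rewrite /conjGL !mulgA mulgK. Qed.

HB.instance Definition _ R := isMultiplicative.Build (GL n F) (GL n F)
  (conjGL R) (conjGL_is_multiplicative R).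

Fact mapGL_is_multiplicative phi : {morph mapGL phi : A B / (A * B)%g}.
Proof. by move=> A B; apply: val_inj; rewrite /= map_mxM. Qed.

HB.instance Definition _ phi := isMultiplicative.Build (GL n F) (GL n F)
  (mapGL phi) (mapGL_is_multiplicative phi).

Fact adjTGLE A : GLmx (adjTGL A) = \det A *: (invmx A)^T.
Proof.
rewrite /= -linearZ; congr trmx.
by rewrite /invmx GLmx_unit scalerA mulfV ?scale1r // detGL_subproof.
Qed.

Fact adjTGL_is_multiplicative : {morph adjTGL : A B / (A * B)%g}.
Proof.
move=> A B; apply: val_inj; rewrite [LHS]adjTGLE.
have -> : val (adjTGL A * adjTGL B)%g = adjTGL A *m adjTGL B by [].
rewrite !adjTGLE -scalemxAl -scalemxAr scalerA -trmx_mul det_mulmx.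
congr (_ *: _^T).
by have /(congr1 val) := invgM A B.
Qed.

HB.instance Definition _ := isMultiplicative.Build (GL n F) (GL n F)
  adjTGL adjTGL_is_multiplicative.

(* Ring morphisms {rmorphism F -> F} preserve 1. *)
Variant basic_map : (GL n F -> GL n F) -> Prop :=
  | BasicConj R : basic_map (conjGL R)
  | BasicAdjT : basic_map adjTGL
  | BasicMap phi : basic_map (mapGL phi).

(* The empty composition, i.e. the identity, is covered by conjGL 1. *)
Inductive basic_composition : (GL n F -> GL n F) -> Prop :=
  | CompBasic f of basic_map f : basic_composition f
  | CompComp f g of basic_composition f & basic_composition g :
      basic_composition (f \o g).

End GLMaps.

(* Main.v *)
(* Fix coordinates by means of the images S_i of the reflections s_i (diagonal,
   with a single entry -1).  The S_i are commuting involutions, so they have a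
   joint eigenvector; non-triviality gives one whose sign pattern T, a set of
   indices, is neither empty nor full.  Images of permutation matrices move it
   to an eigenvector for each sign pattern of size #|T|, and these are linearly
   independent, so 'C(n, #|T|) <= n and #|T| is 1 or n - 1.  Hence, after a
   conjugation, S_i = c s_i with c independent of i.

   Commutation with the S_k now confines the image of a transvection 1 + x e_ij
   to the rows and columns i and j.  As 1 + x e_ij is inverted by s_i and is
   conjugate to its square and its cube by diagonal matrices, that image is
   1 + u e_ij + v e_ji with u v = 0.  The same alternative (v = 0, or u = 0)
   holds for all i, j and x; the second is reduced to the first by passing to
   the inverse transpose.  Finally, if every 1 + x e_ij goes to
   1 + b_ij(x) e_ij, then the action of diagonal matrices forces
   b_ij(x) = (r_i / r_j) phi(x) with phi a ring morphism, and the result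
   follows because transvections and dilatations generate GL(n, F). *)

Require Import Defs.
From HB Require Import structures.
From mathcomp Require Import all_boot all_order all_algebra.
From mathcomp Require Import all_fingroup.
From mathcomp Require Import ring zify.

Set Implicit Arguments.
Unset Strict Implicit.
Unset Printing Implicit Defensive.

Import GRing.Theory.
Local Open Scope ring_scope.

(** * Transvections and dilatations *)

Section Elementary.

Variables (F : fieldType) (n : nat).
Implicit Types (i j k l : 'I_n) (x y t : F).

Definition elmx i j x : 'M[F]_n := 1%:M + x *: delta_mx i j.
(** Dilatations are the diagonal case of [elmx], so they share the product and entry formulas of
    transvections. *)
Definition dilmx i t : 'M[F]_n := elmx i i (t - 1).

Lemma elmxE i j x k l :
  elmx i j x k l = (k == l)%:R + x * ((k == i) && (l == j))%:R.
Proof. by rewrite !mxE. Qed.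

Lemma mul_elmx i j k l x y :
  elmx i j x *m elmx k l y =
    1%:M + x *: delta_mx i j + y *: delta_mx k l
    + (x * y * (j == k)%:R) *: delta_mx i l.
Proof.
rewrite mulmxDl !mulmxDr !mul1mx mulmx1 -scalemxAl -scalemxAr mul_delta_mx_cond.
by rewrite -scaler_nat !scalerA mulrA !addrA [1%:M + _ + _]addrAC.
Qed.

Lemma elmx0 i j : elmx i j 0 = 1%:M.
Proof. by rewrite /elmx scale0r addr0. Qed.

Lemma elmxD i j x y : i != j -> elmx i j (x + y) = elmx i j x *m elmx i j y.
Proof.
move=> /negPf ij; rewrite mul_elmx eq_sym ij mulr0 scale0r addr0.
by rewrite -addrA -scalerDl.
Qed.

Lemma elmx_unit i j x : i != j -> elmx i j x \in unitmx.
Proof.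
move=> ij; suff /mulmx1_unit[] : elmx i j x *m elmx i j (- x) = 1%:M by [].
by rewrite -elmxD // subrr elmx0.
Qed.

Lemma dilmx1 i : dilmx i 1 = 1%:M.
Proof. by rewrite /dilmx subrr elmx0. Qed.

Lemma dilmxM i x y : dilmx i (x * y) = dilmx i x *m dilmx i y.
Proof.
rewrite mul_elmx eqxx mulr1 -!addrA -!scalerDl /dilmx /elmx.
by congr (_ + _ *: _); ring.
Qed.

Lemma dilmx_unit i t : t != 0 -> dilmx i t \in unitmx.
Proof.
move=> t0; suff /mulmx1_unit[] : dilmx i t *m dilmx i t^-1 = 1%:M by [].
by rewrite -dilmxM mulfV // dilmx1.
Qed.

Lemma dilmxC i j x y : dilmx i x *m dilmx j y = dilmx j y *m dilmx i x.
Proof.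
rewrite !mul_elmx (eq_sym j); case: eqP => [->|_].
  by apply/matrixP=> k l; rewrite !mxE; ring.
by rewrite !mulr0 !scale0r !addr0 addrAC.
Qed.

Lemma dilmx_elmxl i j t x : i != j ->
  dilmx i t *m elmx i j x = elmx i j (t * x) *m dilmx i t.
Proof.
move=> /negPf ij; rewrite !mul_elmx eqxx eq_sym ij mulr1 mulr0 scale0r addr0.
by apply/matrixP=> k l; rewrite !mxE; ring.
Qed.

(** Acting on the column index divides the parameter by [t]; putting [t * x] on the left avoids an
    inverse. *)
Lemma dilmx_elmxr i j t x : i != j ->
  dilmx j t *m elmx i j (t * x) = elmx i j x *m dilmx j t.
Proof.
move=> /negPf ij; rewrite !mul_elmx eqxx eq_sym ij mulr1 mulr0 scale0r addr0.
by apply/matrixP=> k l; rewrite !mxE; ring.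
Qed.

Lemma dilmx_elmxC i j k t x : k != i -> k != j ->
  dilmx k t *m elmx i j x = elmx i j x *m dilmx k t.
Proof.
move=> /negPf ki /negPf kj; rewrite !mul_elmx ki eq_sym kj !mulr0 !scale0r.
by rewrite !addr0 addrAC.
Qed.

Lemma dilmx_diag i t : dilmx i t = diag_mx (\row_k if k == i then t else 1).
Proof.
apply/matrixP=> k l; rewrite elmxE !mxE.
have [->|kl] := eqVneq k l; first by rewrite andbb mulr1n; case: eqP => _ /=;
  ring.
suff -> : (k == i) && (l == i) = false by rewrite mulr0 addr0 mulr0n.
by apply: contraNF kl => /andP[/eqP-> /eqP->].
Qed.

Lemma det_dilmx i t : \det (dilmx i t) = t.
Proof.
rewrite dilmx_diag det_diag (bigD1 i) //= mxE eqxx big1 ?mulr1 // => k ki.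
by rewrite mxE (negPf ki).
Qed.

Lemma perm_elmx (s : 'S_n) i j x :
  perm_mx s *m elmx (s i) (s j) x = elmx i j x *m perm_mx s.
Proof.
rewrite -row_permE -[s in RHS]invgK -col_permE; apply/matrixP=> k l.
rewrite !mxE [in LHS](can2_eq (permK s) (permKV s)) (inj_eq perm_inj).
by rewrite [in RHS](can2_eq (permKV s) (permK s)).
Qed.

Lemma perm_dilmx (s : 'S_n) i t :
  perm_mx s *m dilmx (s i) t = dilmx i t *m perm_mx s.
Proof. exact: perm_elmx. Qed.

Lemma mul_elmxE (A : 'M[F]_n) i j x k l :
  (elmx i j x *m A) k l = A k l + x * (A j l *+ (k == i)).
Proof.
rewrite mulmxDl mul1mx -scalemxAl !mxE (bigD1 j) //= !mxE eqxx andbT.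
rewrite big1 ?addr0 ?mulr_natl // => m /negPf mj.
by rewrite !mxE mj andbF mul0r.
Qed.

Lemma mulmx_elmxE (A : 'M[F]_n) i j x k l :
  (A *m elmx i j x) k l = A k l + x * (A k i *+ (l == j)).
Proof.
rewrite mulmxDr mulmx1 -scalemxAr !mxE (bigD1 i) //= !mxE eqxx.
rewrite big1 ?addr0 ?mulr_natr // => m /negPf mi.
by rewrite !mxE mi mulr0.
Qed.

Lemma tr_elmx i j x : (elmx i j x)^T = elmx j i x.
Proof. by rewrite linearD linearZ /= trmx1 trmx_delta. Qed.

Lemma det_elmx i j x : i != j -> \det (elmx i j x) = 1.
Proof.
(* Transposition exchanges the indices, so the lower triangular case suffices. *)
wlog ji : i j / (j < i)%N => [IH ij|ij].
  have [ij'|] := ltnP i j; first by rewrite -det_tr tr_elmx IH // eq_sym.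
  by rewrite leq_eqVlt val_eqE eq_sym (negPf ij) => /IH ->.
rewrite det_trig; first last.
  apply/is_trig_mxP=> k l kl; rewrite elmxE -val_eqE ltn_eqF // add0r.
  suff -> : (k == i) && (l == j) = false by rewrite mulr0.
  by apply/andP=> -[/eqP ki /eqP lj]; move: kl; rewrite ki lj ltnNge ltnW.
apply: big1 => k _; rewrite elmxE eqxx.
suff -> : (k == i) && (k == j) = false by rewrite mulr0 addr0.
by apply: contraNF ij => /andP[/eqP<- /eqP<-].
Qed.

(** The Weyl group element exchanging [i] and [j] up to sign: a quarter turn of that coordinate
    plane. As a product of transvections, its image follows from theirs. *)
Definition weylmx i j : 'M[F]_n := elmx i j 1 *m elmx j i (-1) *m elmx i j 1.

Lemma elmx_inj i j : i != j -> injective (elmx i j).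
Proof.
move=> /negPf ij x y /matrixP/(_ i j); rewrite !elmxE !eqxx ij !add0r.
by rewrite !mulr1.
Qed.

Lemma weylmx_unit i j : i != j -> weylmx i j \in unitmx.
Proof. by move=> ij; rewrite !unitmx_mul !elmx_unit // eq_sym. Qed.

Lemma weylmxE i j : i != j -> weylmx i j =
  1%:M - delta_mx i i - delta_mx j j + delta_mx i j - delta_mx j i.
Proof.
rewrite eq_sym => /negPf ji; rewrite /weylmx mul_elmx eqxx !mulmxDl mul1mx
  -!scalemxAl.
rewrite !mulmxDr !mulmx1 -!scalemxAr !mul_delta_mx_cond eqxx ji.
by apply/matrixP=> k l; rewrite !(mxE, mulr0n, mulr1n); ring.
Qed.

Lemma weylmx_elmx i j x : i != j ->
  weylmx i j *m elmx i j x = elmx j i (- x) *m weylmx i j.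
Proof.
move=> ij; have /negPf ij' := ij; have ji' : (j == i) = false by rewrite eq_sym.
rewrite weylmxE // /elmx.
rewrite !(mulmxDl, mulmxDr, mulmxN, mulNmx, mul1mx, mulmx1) -!scalemxAl
  -!scalemxAr.
rewrite ?(mulmxDl, mulmxDr, mulmxN, mulNmx, mul1mx, mulmx1) !mul_delta_mx_cond.
rewrite !eqxx ij' ji'.
by apply/matrixP=> k l; rewrite !(mxE, mulr0n, mulr1n); ring.
Qed.

Lemma weylmx_sq i j : i != j ->
  weylmx i j *m weylmx i j = dilmx i (-1) *m dilmx j (-1).
Proof.
move=> ij; have /negPf ij' := ij; have ji' : (j == i) = false by rewrite eq_sym.
rewrite weylmxE // /dilmx mul_elmx.
rewrite !(mulmxDl, mulmxDr, mulmxN, mulNmx, mul1mx, mulmx1).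
rewrite !mul_delta_mx_cond !eqxx ij' ji'.
by apply/matrixP=> k l; rewrite !(mxE, mulr0n, mulr1n); ring.
Qed.

(** The Steinberg commutator relation, arranged so that no inverse occurs. *)
Lemma elmx_comm i j k x y : i != j -> j != k -> i != k ->
  elmx i j x *m elmx j k y = elmx i k (x * y) *m (elmx j k y *m elmx i j x).
Proof.
move=> ij jk ik.
have ki : (k == i) = false by rewrite eq_sym (negPf ik).
have kj : (k == j) = false by rewrite eq_sym (negPf jk).
rewrite !mul_elmx eqxx ki /elmx.
rewrite !(mulmxDl, mulmxDr, mul1mx, mulmx1) -!scalemxAl -!scalemxAr.
rewrite !mul_delta_mx_cond kj ki.
by apply/matrixP=> a b; rewrite !(mxE, mulr0n, mulr1n); ring.
Qed.

End Elementary.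

Lemma offdiag0_neq0 (F : fieldType) n (A : 'M[F]_n) k :
  A \in unitmx -> (forall i j, i != j -> A i j = 0) -> A k k != 0.
Proof.
move=> uA A0; apply/eqP=> Akk; have : A *m delta_mx k k = 0 :> 'M_n.
  apply/matrixP=> l m; rewrite !mxE big1 // => p _; rewrite !mxE.
  have [->|lp] := eqVneq l p; last by rewrite A0 ?mul0r.
  by case: (eqVneq p k) => [->|] /=; rewrite ?Akk ?mul0r ?mulr0.
move/(congr1 (mulmx (invmx A))); rewrite mulKmx // mulmx0 => /matrixP/(_ k k).
by rewrite !mxE !eqxx => /eqP; rewrite oner_eq0.
Qed.

(** * Generation of GL by transvections and the dilatations of one index *)

Section Generation.

Variable F : fieldType.

Lemma block_elmx_dr n (i : 'I_n) (j : 'I_n) x :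
  block_mx 1%:M 0 0 (elmx i j x) = elmx (rshift 1 i) (rshift 1 j) x :> 'M[F]_(1
    + n).
Proof.
rewrite /elmx (@scalar_mx_block _ 1 n).
have -> : delta_mx (rshift 1 i) (rshift 1 j) = block_mx 0 0 0 (delta_mx i j)
    :> 'M[F]_(1 + n).
  apply/matrixP=> k l; rewrite -(splitK k) -(splitK l) /unsplit.
  by case: (split k) => k'; case: (split l) => l';
     rewrite ?(block_mxEul, block_mxEur, block_mxEdl, block_mxEdr) !mxE
       ?eq_shift ?andbF.
by rewrite scale_block_mx add_block_mx !scaler0 ?addr0 ?add0r.
Qed.

Lemma block_elmx_dl n (i : 'I_n) (j : 'I_1) x :
  block_mx 1%:M 0 (x *: delta_mx i j) 1%:M = elmx (rshift 1 i) (lshift n j) x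
    :> 'M[F]_(1 + n).
Proof.
rewrite /elmx (@scalar_mx_block _ 1 n).
have -> : delta_mx (rshift 1 i) (lshift n j) = block_mx 0 0 (delta_mx i j) 0
    :> 'M[F]_(1 + n).
  apply/matrixP=> k l; rewrite -(splitK k) -(splitK l) /unsplit.
  by case: (split k) => k'; case: (split l) => l';
     rewrite ?(block_mxEul, block_mxEur, block_mxEdl, block_mxEdr) !mxE
       ?eq_shift ?andbF.
by rewrite scale_block_mx add_block_mx !scaler0 ?addr0 ?add0r.
Qed.

Lemma block_elmx_ur n (i : 'I_1) (j : 'I_n) x :
  block_mx 1%:M (x *: delta_mx i j) 0 1%:M = elmx (lshift n i) (rshift 1 j) x
    :> 'M[F]_(1 + n).
Proof.
rewrite /elmx (@scalar_mx_block _ 1 n).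
have -> : delta_mx (lshift n i) (rshift 1 j) = block_mx 0 (delta_mx i j) 0 0
    :> 'M[F]_(1 + n).
  apply/matrixP=> k l; rewrite -(splitK k) -(splitK l) /unsplit.
  by case: (split k) => k'; case: (split l) => l';
     rewrite ?(block_mxEul, block_mxEur, block_mxEdl, block_mxEdr) !mxE
       ?eq_shift ?andbF.
by rewrite scale_block_mx add_block_mx !scaler0 ?addr0 ?add0r.
Qed.

(** Gaussian elimination by induction on the size: once the corner entry is 1, clearing its row and
    column leaves a smaller block. Dilatations at [ord_max] suffice because this index remains the
    last one when the block is embedded. *)
Lemma unitmx_elementary_ind n (P : 'M[F]_n.+1 -> Prop) :
    (forall A B, A \in unitmx -> B \in unitmx -> P A -> P B -> P (A *m B)) ->
    (forall i j x, i != j -> P (elmx i j x)) ->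
    (forall t, t != 0 -> P (dilmx ord_max t)) ->
  forall A, A \in unitmx -> P A.
Proof.
elim: n => [|n IHn] in P * => PM PE PD A uA.
  have -> : A = dilmx ord_max (A 0 0).
    apply/matrixP=> i j; rewrite elmxE (ord1 i) (ord1 j) eqxx mulr1 mulr1n.
    by rewrite addrC subrK.
  by apply: PD; move: uA; rewrite unitmxE det_mx11 unitfE.
have PE1 : P 1%:M by rewrite -(elmx0 F ord0 ord_max); apply: (PE).
have PB (B : 'M_n.+1) : B \in unitmx -> P (block_mx 1%:M 0 0 B : 'M_(1 + n.+1)).
  move: B; apply: IHn => [B C uB uC PB PC|i j x ij|t t0].
  - have -> : block_mx 1%:M 0 0 (B *m C) =
       (block_mx 1%:M 0 0 B : 'M_(1 + n.+1)) *m (block_mx 1%:M 0 0 C : 'M_(1 +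
         n.+1)).
      by rewrite mulmx_block !mulmx0 !mul0mx !mulmx1 !addr0 !add0r.
    by apply: (PM) => //; rewrite unitmxE (@det_lblock _ 1) det1 mul1r -unitmxE.
  - by rewrite block_elmx_dr; apply: (PE); rewrite (inj_eq (@rshift_inj 1
    n.+1)).
  rewrite block_elmx_dr.
  have -> : rshift 1 ord_max = ord_max :> 'I_n.+2 by apply: val_inj.
  exact: PD.
have uL (c : 'cV[F]_n.+1) : (block_mx 1%:M 0 c 1%:M : 'M_(1 + n.+1)) \in unitmx.
  by rewrite unitmxE (@det_lblock _ 1) !det1 mulr1 unitr1.
have uR (c : 'rV[F]_n.+1) : (block_mx 1%:M c 0 1%:M : 'M_(1 + n.+1)) \in unitmx.
  by rewrite unitmxE (@det_ublock _ 1) !det1 mulr1 unitr1.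
have PL (c : 'cV[F]_n.+1) : P (block_mx 1%:M 0 c 1%:M : 'M_(1 + n.+1)).
  pose Q c := P (block_mx 1%:M 0 c 1%:M : 'M_(1 + n.+1)).
  have Q0 : Q 0 by rewrite /Q -(@scalar_mx_block _ 1).
  have QD c1 c2 : Q c1 -> Q c2 -> Q (c1 + c2).
    rewrite /Q => Q1 Q2; have := PM _ _ (uL c1) (uL c2) Q1 Q2.
    by rewrite (@mulmx_block _ 1 n.+1 1 n.+1 1 n.+1) !mulmx0 !mul0mx !mulmx1
      !mul1mx !addr0 !add0r.
  rewrite -/(Q c) [c]matrix_sum_delta; apply: (big_ind Q) => // i _.
  apply: (big_ind Q) => // j _; rewrite /Q.
  by rewrite block_elmx_dl; apply: (PE); rewrite -val_eqE /= (ord1 j).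
have PR (c : 'rV[F]_n.+1) : P (block_mx 1%:M c 0 1%:M : 'M_(1 + n.+1)).
  pose Q c := P (block_mx 1%:M c 0 1%:M : 'M_(1 + n.+1)).
  have Q0 : Q 0 by rewrite /Q -(@scalar_mx_block _ 1).
  have QD c1 c2 : Q c1 -> Q c2 -> Q (c1 + c2).
    rewrite /Q addrC => Q1 Q2; have := PM _ _ (uR c1) (uR c2) Q1 Q2.
    by rewrite (@mulmx_block _ 1 n.+1 1 n.+1 1 n.+1) !mulmx0 !mul0mx !mulmx1
      !mul1mx !addr0 !add0r.
  rewrite -/(Q c) [c]matrix_sum_delta; apply: (big_ind Q) => // i _.
  apply: (big_ind Q) => // j _; rewrite /Q.
  by rewrite block_elmx_ur; apply: (PE); rewrite -val_eqE /= (ord1 i).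
have P1 (B : 'M[F]_(1 + n.+1)) : B \in unitmx -> B 0 0 = 1 -> P B.
  move=> uB B00.
  pose c := dlsubmx B; pose r := ursubmx B.
  have dB : B = block_mx 1%:M 0 c 1%:M *m block_mx 1%:M 0 0 (drsubmx B - c *m
    r) *m
                block_mx 1%:M r 0 1%:M.
    rewrite !mulmx_block !(mulmx0, mul0mx, mulmx1, mul1mx, addr0, add0r).
    rewrite addrC subrK -[LHS]submxK; congr block_mx.
    apply/matrixP=> i j; rewrite !mxE !ord1 eqxx -B00; congr (B _ _);
      exact: val_inj.
  move: (uB); rewrite dB !unitmx_mul => /andP[/andP[_ uD] _].
  have uD' : drsubmx B - c *m r \in unitmx.
    by move: uD; rewrite !unitmxE (@det_lblock _ 1) det1 mul1r.
  apply: (PM); rewrite ?unitmx_mul ?uL ?uR //.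
  by apply: (PM); rewrite ?uL //; apply: (PB).
have PS i j x B : i != j -> B \in unitmx -> P (elmx i j x *m B) -> P B.
  move=> ij uB PEB.
  have -> : B = elmx i j (- x) *m (elmx i j x *m B).
    by rewrite mulmxA -elmxD // addNr elmx0 mul1mx.
  by apply: (PM); rewrite ?unitmx_mul ?elmx_unit //; apply: (PE).
(* A nonzero entry below the corner allows a multiple of its row to be added to row 0 so that the
   corner becomes 1. *)
have P2 (B : 'M[F]_n.+2) i : B \in unitmx -> i != 0 -> B i 0 != 0 -> P B.
  move=> uB i0 Bi0; apply: (@PS 0 i ((1 - B 0 0) / B i 0)); rewrite 1?eq_sym //.
  apply: P1; first by rewrite unitmx_mul elmx_unit // eq_sym.
  by rewrite mul_elmxE eqxx mulr1n divfK // addrC subrK.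
case: (pickP [pred i | (i != 0) && (A i 0 != 0)]) => [i /andP[i0 Ai0]|A0].
  exact: P2 Ai0.
have A00 : A 0 0 != 0.
  apply/eqP=> A00; have : A *m delta_mx 0 0 = 0 :> 'cV_n.+2.
    rewrite -colE; apply/matrixP=> i j; rewrite !mxE.
    have /= := A0 i; have [-> //|_ /= /negbFE/eqP //] := eqVneq i 0.
  move/(congr1 (mulmx (invmx A))); rewrite mulKmx // mulmx0 => /matrixP/(_ 0 0).
  by rewrite !mxE => /eqP; rewrite oner_eq0.
(* Only the corner of column 0 is nonzero here; adding row 0 to the last row creates the entry that
   [P2] needs. *)
apply: (@PS ord_max 0 1) => //; apply: (@P2 _ ord_max) => //.
  by rewrite unitmx_mul elmx_unit.
rewrite mul_elmxE eqxx mulr1n mul1r.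
by have /= /negbFE/eqP -> := A0 ord_max; rewrite add0r.
Qed.

End Generation.

(** * Maps preserving transvections *)

(** A total function on matrices, constrained on invertible ones only, so that matrix algebra
    applies without bundled invertibility proofs. *)
Definition GLmorph (F : fieldType) n (f : 'M[F]_n -> 'M[F]_n) :=
  {homo f : A / A \in unitmx} /\ {in unitmx &, {morph f : A B / A *m B}}.

Lemma GLmorph1 (F : fieldType) n (f : 'M[F]_n -> 'M[F]_n) :
  GLmorph f -> f 1%:M = 1%:M.
Proof.
case=> fU fM; have u1 := unitmx1 F n.
by rewrite -(mulKmx (fU _ u1) (f 1%:M)) -fM // mul1mx mulVmx // fU.
Qed.

Lemma rmorphism_ex (F : fieldType) (phi : F -> F) :
    {morph phi : x y / x + y} -> {morph phi : x y / x * y} -> phi 1 = 1 ->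
  exists psi : {rmorphism F -> F}, psi =1 phi.
Proof.
move=> phiD phiM phi1.
have phiB : zmod_morphism phi.
  by move=> x y; apply/eqP; rewrite eq_sym subr_eq -phiD subrK.
pose a := GRing.isZmodMorphism.Build F F phi phiB.
pose m := GRing.isMonoidMorphism.Build F F phi (conj phi1 phiM).
pose psi : {rmorphism F -> F} := HB.pack phi a m.
by exists psi.
Qed.

Section Rigidity.

Variables (F : fieldType) (n : nat).
Variable f : 'M[F]_n.+2 -> 'M[F]_n.+2.
Variable b : 'I_n.+2 -> 'I_n.+2 -> F -> F.
Hypothesis f_morph : GLmorph f.
Hypothesis f_elmx : forall i j x, i != j -> f (elmx i j x) = elmx i j (b i j x).
Hypothesis b_neq0 : forall i j x, i != j -> x != 0 -> b i j x != 0.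

Implicit Types (i j k : 'I_n.+2) (x y t : F).

Let fM A B : A \in unitmx -> B \in unitmx -> f (A *m B) = f A *m f B.
Proof. by case: f_morph => _; apply. Qed.

Let fU A : A \in unitmx -> f A \in unitmx.
Proof. by case: f_morph => + _; apply. Qed.

Let bD i j x y : i != j -> b i j (x + y) = b i j x + b i j y.
Proof.
move=> ij; apply: (elmx_inj ij); rewrite -f_elmx // !elmxD // fM ?elmx_unit //.
by rewrite !f_elmx.
Qed.

Let b0 i j : i != j -> b i j 0 = 0.
Proof. by move=> ij; apply: (addrI (b i j 0)); rewrite -bD // !addr0. Qed.

Let elmx_intertwine (X : 'M[F]_n.+2) i j y z l :
  X *m elmx i j y = elmx i j z *m X -> z * X j l = y * (X i i *+ (l == j)).
Proof.
move/matrixP/(_ i l); rewrite mulmx_elmxE mul_elmxE eqxx mulr1n.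
by move/addrI.
Qed.

Let X i t := f (dilmx i t).

Let X_left i j t x l : i != j -> t != 0 ->
  b i j (t * x) * X i t j l = b i j x * (X i t i i *+ (l == j)).
Proof.
move=> ij t0; apply: elmx_intertwine.
by rewrite -!f_elmx // -!fM ?dilmx_elmxl ?dilmx_unit ?elmx_unit.
Qed.

Let X_right i j t x l : i != j -> t != 0 ->
  b j i x * X i t i l = b j i (t * x) * (X i t j j *+ (l == i)).
Proof.
move=> ij t0; have ji : j != i by rewrite eq_sym.
apply: elmx_intertwine.
by rewrite -!f_elmx // -!fM ?dilmx_elmxr ?dilmx_unit ?elmx_unit.
Qed.

Let X_comm i j k t : i != j -> i != k -> t != 0 -> X i t j j = X i t k k.
Proof.
have [-> //|jk] := eqVneq j k => ij ik t0.
have : X i t *m elmx j k (b j k 1) = elmx j k (b j k 1) *m X i t.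
  by rewrite -!f_elmx // -!fM ?dilmx_elmxC ?dilmx_unit ?elmx_unit.
move/(@elmx_intertwine _ _ _ _ _ k); rewrite eqxx mulr1n.
by move/mulfI => -> //; rewrite b_neq0 ?oner_eq0.
Qed.

(** Row [i] is settled by [X_right], any other row [k] by [X_left] for the pair [i], [k]. *)
Let X_offdiag i t k l : t != 0 -> k != l -> X i t k l = 0.
Proof.
move=> t0 kl; have [ki|ki] := eqVneq k i.
  have [j ij] : exists j, i != j.
    by exists l; rewrite -ki.
  apply: (mulfI (b_neq0 (i := j) (j := i) _ (oner_neq0 F)));
    first by rewrite eq_sym.
  have li : (l == i) = false by rewrite -ki eq_sym (negPf kl).
  by rewrite ki X_right // li mulr0n !mulr0.
have ik : i != k by rewrite eq_sym.
apply: (mulfI (b_neq0 ik (mulf_neq0 t0 (oner_neq0 F)))).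
by rewrite X_left // eq_sym (negPf kl) mulr0n !mulr0.
Qed.

Let X_diag i t k : t != 0 -> X i t k k != 0.
Proof.
by move=> t0; apply: offdiag0_neq0 => [|*]; [apply/fU/dilmx_unit|apply:
  X_offdiag].
Qed.

(* Any index different from i would do. *)
Let other i := if i == ord0 then ord_max else ord0 : 'I_n.+2.

Let otherP i : i != other i.
Proof. by rewrite /other; case: (eqVneq i ord0) => [->|]. Qed.

(** The image of [dilmx i t] is diagonal, and constant away from [i] by [X_comm]; this ratio is the
    factor by which conjugation by it scales transvections with row index [i]. *)
Let r i t := X i t i i / X i t (other i) (other i).

Let b_left i j t x : i != j -> t != 0 -> b i j (t * x) = r i t * b i j x.
Proof.
move=> ij t0; apply: (mulIf (X_diag i j t0)).
rewrite X_left // eqxx mulr1n /r (@X_comm _ (other i) j) ?otherP //.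
by rewrite mulrAC divfK ?X_diag // mulrC.
Qed.

Let b_right i j t x : i != j -> t != 0 -> b j i (t * x) = r i t * b j i x.
Proof.
move=> ij t0; apply: (mulIf (X_diag i j t0)).
have := X_right x i ij t0; rewrite eqxx mulr1n => <-.
rewrite /r (@X_comm _ (other i) j) ?otherP //.
by rewrite mulrAC divfK ?X_diag // mulrC.
Qed.

(** Both are the factor relating [b i j (t * x)] to [b i j x]: one comes from acting on the row
    index, the other from the column index. *)
Let r_indep i j t : t != 0 -> r i t = r j t.
Proof.
have [-> //|ij] := eqVneq i j => t0.
have ji : j != i by rewrite eq_sym.
by apply: (mulIf (b_neq0 ij (oner_neq0 F))); rewrite -b_left // -b_right.
Qed.

Let phi x := b ord0 ord_max x / b ord0 ord_max 1.

Let phiE i j x : i != j -> b i j x = b i j 1 * phi x.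
Proof.
move=> ij; have [->|x0] := eqVneq x 0; first by rewrite /phi !b0 // mul0r mulr0.
have o1 := b_neq0 (isT : ord0 != ord_max :> 'I_n.+2) (oner_neq0 F).
rewrite /phi -{1 2}[x]mulr1 !b_left // mulfK // (r_indep i ord0) //.
by rewrite mulrC.
Qed.

Let r_phi i t : t != 0 -> r i t = phi t.
Proof.
move=> t0; rewrite (r_indep i ord0) // /phi -[in RHS](mulr1 t) b_left //
  mulfK //.
exact: b_neq0 (oner_neq0 F).
Qed.

(** Additivity is that of [b]; multiplicativity holds because scaling the argument by [x] multiplies
    [b] by [r ord0 x], which is [phi x]. *)
Let phi_rmorphism : exists psi : {rmorphism F -> F}, psi =1 phi.
Proof.
have o1 := b_neq0 (isT : ord0 != ord_max :> 'I_n.+2) (oner_neq0 F).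
apply: rmorphism_ex => [x y|x y|]; first by rewrite /phi bD // mulrDl.
  have [->|x0] := eqVneq x 0; first by rewrite /phi mul0r b0 // !mul0r.
  by rewrite {1}/phi b_left // -mulrA (r_phi _ x0).
by rewrite /phi divff.
Qed.

(** The Weyl element carries [elmx i j 1] to [elmx j i (-1)]. Comparing entries [(i, j)] of the
    images shows that entry [(i, i)] of its image vanishes, and that entry is
    [1 - b i j 1 * b j i 1]. *)
Let b_inv i j : i != j -> b i j 1 * b j i 1 = 1.
Proof.
move=> ij; have ji : j != i by rewrite eq_sym.
have uw := weylmx_unit F ij.
have /matrixP/(_ i j) : f (weylmx F i j) *m f (elmx i j 1) =
    f (elmx j i (-1)) *m f (weylmx F i j).
  by rewrite -!fM ?weylmx_elmx ?elmx_unit.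
rewrite !f_elmx // mulmx_elmxE mul_elmxE (negPf ij) eqxx mulr1n mulr0n mulr0.
move/addrI/eqP; rewrite mulf_eq0 (negPf (b_neq0 _ _)) ?oner_eq0 //=.
rewrite /weylmx !fM ?unitmx_mul ?elmx_unit // !f_elmx //.
rewrite !mulmx_elmxE !elmxE !eqxx (negPf ij) !mulr0n !mulr0 !addr0 add0r !mulr1.
have -> : b j i (-1) = - b j i 1.
  by apply/eqP; rewrite -addr_eq0 -bD // addNr b0.
by rewrite mulNr subr_eq0 mulrC => /eqP.
Qed.

Let b_trans i j k : i != j -> j != k -> i != k -> b i k 1 = b i j 1 * b j k 1.
Proof.
move=> ij jk ik; have := @elmx_comm F _ _ _ _ 1 1 ij jk ik.
move=> /(congr1 f); rewrite !fM ?unitmx_mul ?elmx_unit // !f_elmx //.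
rewrite elmx_comm // mulr1.
set Y := elmx j k _ *m _ => eqY.
have uY : Y \in unitmx by rewrite unitmx_mul !elmx_unit.
by apply/esym/(elmx_inj ik)/(can_inj (mulmxK uY)).
Qed.

(** By [b_inv] and [b_trans] the constants [b i j 1] have the form [s i / s j], so the diagonal
    matrix of the [s i] normalises them to 1. The formula is then checked on generators. *)
Lemma GLmorph_rigidity :
  exists (psi : {rmorphism F -> F}) (mu : F -> F) (Q : 'M[F]_n.+2),
    [/\ Q \in unitmx, forall x, x != 0 -> mu x != 0,
        forall x y, x != 0 -> y != 0 -> mu (x * y) = mu x * mu y
      & forall A, A \in unitmx ->
          f A = mu (\det A) *: (Q *m map_mx psi A *m invmx Q)].
Proof.
have [psi psiE] := phi_rmorphism.
pose s i := if i == ord0 then 1 else b i ord0 1.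
have s0 i : s i != 0.
  by rewrite /s; case: (eqVneq i ord0) => // i0;
    rewrite ?oner_eq0 // b_neq0 ?oner_eq0.
have bs i j : i != j -> b i j 1 * s j = s i.
  rewrite /s => ij; case: (eqVneq j ord0) => [j0|j0];
    case: (eqVneq i ord0) => [i0|i0].
  - by move: ij; rewrite i0 j0 eqxx.
  - by rewrite j0 mulr1.
  - by rewrite i0 b_inv // eq_sym.
  - by rewrite -b_trans.
pose Q := diag_mx (\row_i s i).
have uQ : Q \in unitmx.
  by rewrite unitmxE det_diag unitfE prodf_seq_neq0; apply/allP=> i _;
    rewrite mxE s0.
(* The image of [dilmx ord_max t] is constant on the diagonal away from [ord_max]; this common entry
   is the scalar attached to determinant [t]. *)
pose mu t := X ord_max t ord0 ord0.
have muM x y : x != 0 -> y != 0 -> mu (x * y) = mu x * mu y.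
  move=> x0 y0; rewrite /mu /X dilmxM fM ?dilmx_unit // mxE (bigD1 ord0) //=.
  rewrite big1 ?addr0 // => k k0.
  by rewrite (_ : f (dilmx ord_max x) ord0 k = 0) ?mul0r // X_offdiag // eq_sym.
have mu0 x : x != 0 -> mu x != 0 by exact: X_diag.
have mu1 : mu 1 = 1.
  by apply: (mulfI (mu0 _ (oner_neq0 F))); rewrite -muM ?oner_eq0 ?mulr1.
exists psi, mu, Q; split=> //.
apply: unitmx_elementary_ind => [A B uA uB fA fB|i j x ij|t t0].
- rewrite fM // fA fB -scalemxAl -scalemxAr scalerA det_mulmx muM -?unitfE
  -?unitmxE //.
  by rewrite map_mxM !mulmxA mulmxKV.
- rewrite det_elmx // mu1 scale1r f_elmx //.
  apply: (can_inj (mulmxK uQ)); rewrite mulmxKV // mul_diag_mx mul_mx_diag.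
  apply/matrixP=> k l; rewrite !mxE !rmorphD !rmorphM /= !rmorph_nat psiE.
  rewrite mulrDl mulrDr; congr (_ + _).
    by case: eqVneq => [->|]; rewrite ?mulr0 ?mul0r // mulrC.
  case: (eqVneq k i) => [->|]; rewrite ?mulr0 ?mul0r //=.
  case: (eqVneq l j) => [->|]; rewrite ?mulr0 ?mul0r //= !mulr1.
  by rewrite (phiE x ij) mulrAC bs.
rewrite det_dilmx; apply: (can_inj (mulmxK uQ)).
rewrite -scalemxAl mulmxKV // mul_diag_mx mul_mx_diag.
apply/matrixP=> k l; rewrite -/(X ord_max t) !mxE !rmorphD !rmorphM /=
  !rmorph_nat.
rewrite rmorphB rmorph1 psiE.
have [<-|kl] := eqVneq k l; last first.
  rewrite X_offdiag // mul0r; suff -> : (k == ord_max) && (l == ord_max) =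
    false.
    by rewrite mulr0 addr0 !mulr0.
  by apply: contraNF kl => /andP[/eqP-> /eqP->].
rewrite andbb mulr1n; have [->|km] := eqVneq k ord_max.
  rewrite mulr1 [1 + _]addrC subrK -(r_phi ord_max t0) /r /other /=.
  rewrite [s _ * _]mulrC mulrA; congr (_ * _).
  by rewrite mulrC divfK // X_diag.
rewrite mulr0 addr0 mulr1; congr (_ * _).
by apply: X_comm; rewrite // eq_sym.
Qed.

End Rigidity.

(** * Images of the reflections *)

Lemma perm_pair_ex (T : finType) (i j k l : T) : i != j -> k != l ->
  exists s : {perm T}, s k = i /\ s l = j.
Proof.
move=> ij kl; have l'i : tperm k i l != i.
  by rewrite -[X in _ != X](tpermL k i) (inj_eq perm_inj) eq_sym.
exists (tperm k i * tperm (tperm k i l) j)%g; rewrite !permM tpermL.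
by rewrite [X in X = _ /\ _]tpermD ?tpermL // eq_sym.
Qed.

(** The hypotheses force size 2; the formula does not depend on which of the two indices is called
    [i]. *)
Lemma det_pair (F : fieldType) n (A : 'M[F]_n.+2) i j :
    i != j -> (forall k, (k == i) || (k == j)) ->
  \det A = A i i * A j j - A i j * A j i.
Proof.
move=> ij kij; case: n => [|n] in A i j ij kij *; last first.
  have : (#|'I_n.+3| <= #|[:: i; j]|)%N.
    by apply/subset_leq_card/subsetP=> k _; rewrite !inE.
  by move/leq_trans/(_ (card_size _)); rewrite card_ord.
have detA : \det A = A 0 0 * A 1 1 - A 0 1 * A 1 0.
  rewrite (expand_det_row _ 0) !big_ord_recl big_ord0 /cofactor !det_mx11 !mxE
    /=.
  have -> : lift ord0 ord0 = 1 :> 'I_2 by exact: val_inj.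
  have -> : lift 1 0 = 0 :> 'I_2 by exact: val_inj.
  by rewrite /bump /=; ring.
have I2 (k : 'I_2) : k = 0 \/ k = 1.
  by case: k => [[|[|//]] ?]; [left|right]; apply: val_inj.
rewrite detA; move: ij.
by case: (I2 i) => ->; case: (I2 j) => -> //= _; ring.
Qed.

(** * Non-triviality on transvections and distinct images of reflections *)

Section Nontrivial.

Variables (F : fieldType) (n : nat) (f : 'M[F]_n.+2 -> 'M[F]_n.+2).
Hypothesis charF : [pchar F] =i pred0.
Hypothesis f_morph : GLmorph f.
Hypothesis f_nontrivial :
  ~ forall A, A \in unitmx -> \det A = 1 -> f A = 1%:M.

Implicit Types (i j k l : 'I_n.+2) (x y t : F).

Let fM A B : A \in unitmx -> B \in unitmx -> f (A *m B) = f A *m f B.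
Proof. by case: f_morph => _; apply. Qed.

Let fU A : A \in unitmx -> f A \in unitmx.
Proof. by case: f_morph => + _; apply. Qed.

Let natF m : (m.+1%:R : F) != 0.
Proof. by have /pcharf0P -> := charF. Qed.

Let f1 : f 1%:M = 1%:M := GLmorph1 f_morph.

Let f_conj1 Z A B : Z \in unitmx -> A \in unitmx -> B \in unitmx ->
  Z *m A = B *m Z -> f A = 1%:M -> f B = 1%:M.
Proof.
move=> uZ uA uB /(congr1 f); rewrite !fM // => + fA; rewrite fA mulmx1.
by move/(congr1 (mulmx^~ (invmx (f Z)))); rewrite mulmxK ?mulmxV ?fU.
Qed.

(** If one transvection were killed, so would be its conjugates by dilatations and permutation
    matrices, hence all transvections. Then [f] would factor through the determinant and be trivial
    on SL. *)
Lemma GLmorph_elmx_neq1 i j x : i != j -> x != 0 -> f (elmx i j x) != 1%:M.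
Proof.
move=> ij x0; apply/eqP=> fx; apply: f_nontrivial.
have fij y : f (elmx i j y) = 1%:M.
  have [->|y0] := eqVneq y 0; first by rewrite elmx0.
  have t0 : y / x != 0 by rewrite mulf_neq0 ?invr_eq0.
  apply: (f_conj1 (dilmx_unit i t0) (elmx_unit x ij)) fx; rewrite ?elmx_unit //.
  by rewrite dilmx_elmxl // divfK.
have fkl k l y : k != l -> f (elmx k l y) = 1%:M.
  move=> kl; have [s [sk sl]] := perm_pair_ex ij kl.
  apply: (f_conj1 (unitmx_perm _ s) (elmx_unit y ij)) (fij y);
    rewrite ?elmx_unit //.
  by rewrite -perm_elmx sk sl.
suff fdet A : A \in unitmx -> f A = f (dilmx ord_max (\det A)).
  by move=> A uA dA; rewrite fdet // dA dilmx1.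
move: A; apply: unitmx_elementary_ind => [A B uA uB fA fB|k l y kl|t t0].
- rewrite fM // fA fB det_mulmx dilmxM fM // dilmx_unit //;
  by rewrite -unitfE -unitmxE.
- by rewrite fkl // det_elmx // dilmx1.
by rewrite det_dilmx.
Qed.

(** Conjugation by [dilmx i 2] squares the transvection, so this determinant equals its own
    square. *)
Lemma det_GLmorph_elmx i j x : i != j -> \det (f (elmx i j x)) = 1.
Proof.
move=> ij; have uE := elmx_unit x ij; have u2 := dilmx_unit i (natF 1).
have := congr1 f (dilmx_elmxl 2 x ij); rewrite mulr_natl mulr2n elmxD //
  !fM //; last first.
  by rewrite unitmx_mul uE.
move/(congr1 determinant); rewrite !det_mulmx.
have u2' : \det (f (dilmx i 2)) != 0 by rewrite -unitfE -unitmxE fU.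
have uE' : \det (f (elmx i j x)) != 0 by rewrite -unitfE -unitmxE fU.
by rewrite mulrC => /(mulIf u2') /esym; rewrite -[X in _ = X]mulr1 =>
  /(mulfI uE').
Qed.

Let refl_comm i j : i != j -> f (dilmx i (-1)) = f (dilmx j (-1)) ->
  f (dilmx i (-1) *m dilmx j (-1)) = 1%:M.
Proof.
move=> ij fij; have N1 : (-1 : F) != 0 by rewrite oppr_eq0 oner_eq0.
by rewrite fM ?dilmx_unit // -fij -fM ?dilmx_unit //
  -dilmxM mulrNN mulr1 dilmx1.
Qed.

(** Otherwise [f] kills the product of the two reflections, which inverts [elmx i k 1]; then
    [elmx i k 2] is killed as well. *)
Let refl_neq_big i j k : i != j -> k != i -> k != j ->
  f (dilmx i (-1)) != f (dilmx j (-1)).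
Proof.
move=> ij ki kj; apply/eqP=> /(refl_comm ij) fT.
have N1 : (-1 : F) != 0 by rewrite oppr_eq0 oner_eq0.
have ik : i != k by rewrite eq_sym.
have ji : j != i by rewrite eq_sym.
have jk : j != k by rewrite eq_sym.
have eqT : dilmx i (-1) *m dilmx j (-1) *m elmx i k 1 =
    elmx i k (-1) *m (dilmx i (-1) *m dilmx j (-1)) :> 'M[F]_n.+2.
  rewrite -mulmxA (dilmx_elmxC _ _ ji jk).
  by rewrite mulmxA dilmx_elmxl // mulr1 mulmxA.
have uT : dilmx i (-1 : F) *m dilmx j (-1 : F) \in unitmx.
  by rewrite unitmx_mul !dilmx_unit.
have := congr1 f eqT; rewrite fM ?elmx_unit // [in RHS]fM ?elmx_unit //
  fT mulmx1 mul1mx.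
move=> fE; have /negP[] := GLmorph_elmx_neq1 ik (natF 1).
by rewrite mulr2n elmxD // fM ?elmx_unit // {1}fE -fM ?elmx_unit //
  -elmxD // addNr elmx0 f1.
Qed.

(* For 2 x 2 matrices the image W of the Weyl element is an involution of
   determinant 1, hence scalar, which identifies the images of the two root
   subgroups; then W is the image of elmx i j 3, and W^2 = 1 kills elmx i j 6. *)
Let refl_neq_small i j : i != j -> (forall k, (k == i) || (k == j)) ->
  f (dilmx i (-1)) != f (dilmx j (-1)).
Proof.
move=> ij kij; apply/eqP=> /(refl_comm ij) fT.
have ji : j != i by rewrite eq_sym.
have uw := weylmx_unit F ij; set W := f (weylmx F i j).
have WW : W *m W = 1%:M by rewrite -fM // weylmx_sq.
have dW : \det W = 1.
  by rewrite /W /weylmx !fM ?unitmx_mul ?elmx_unit //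
    !det_mulmx !det_GLmorph_elmx ?mulr1.
have sumE (G : 'I_n.+2 -> F) : \sum_k G k = G i + G j.
  rewrite (bigD1 i) //= (bigD1 j) //= big1 ?addr0 // => k /andP[ki kj].
  by have := kij k; rewrite (negPf ki) (negPf kj).
have W2 k l : W k i * W i l + W k j * W j l = (k == l)%:R.
  by have /matrixP/(_ k l) := WW; rewrite !mxE sumE.
have detE := det_pair W ij kij; rewrite dW in detE.
(* Cayley-Hamilton in entries: with [W *m W = 1] and determinant 1, the trace times [W] is the
   scalar 2. *)
have trW : W i i * (W i i + W j j) = 2.
  have := W2 i i; rewrite eqxx => h.
  transitivity ((W i i * W j j - W i j * W j i) + (W i i * W i i + W i j * W j
    i)).
    by ring.
  by rewrite -detE h.
have tr0 : W i i + W j j != 0.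
  by apply/eqP=> t0; move: trW (natF 1); rewrite t0 mulr0 => <-; rewrite eqxx.
have Wij : W i j = 0.
  have := W2 i j; rewrite (negPf ij) => h.
  by apply: (mulIf tr0); rewrite mul0r -[RHS]h; ring.
have Wji : W j i = 0.
  have := W2 j i; rewrite (negPf ji) => h.
  by apply: (mulIf tr0); rewrite mul0r -[RHS]h; ring.
have Wjj : W j j = W i i.
  have := W2 i i; have := detE; rewrite Wij mul0r subr0 addr0 eqxx mulr1n =>
    -> /mulfI -> //.
  by apply/eqP=> w0; move: trW (natF 1); rewrite w0 mul0r => <-; rewrite eqxx.
have Wc : W = (W i i)%:M.
  apply/matrixP=> k l; rewrite mxE.
  have /orP[/eqP->|/eqP->] := kij k; have /orP[/eqP->|/eqP->] := kij l;
    by rewrite ?eqxx ?(negPf ij) ?(negPf ji) ?mulr1n ?mulr0n.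
pose U := f (elmx i j 1).
have UE : f (elmx j i (-1)) = U.
  apply: (can_inj (mulmxK (fU uw))); rewrite -fM ?elmx_unit // -weylmx_elmx //.
  by rewrite fM ?elmx_unit // -/W Wc scalar_mxC.
have WU : W = f (elmx i j 3).
  rewrite /W /weylmx !fM ?unitmx_mul ?elmx_unit //
    UE /U -!fM ?unitmx_mul ?elmx_unit //.
  by rewrite -!elmxD //; congr (f (elmx i j _)); ring.
have /negP[] := GLmorph_elmx_neq1 ij (natF 5).
have -> : 6 = 3 + 3 :> F by ring.
by rewrite elmxD // fM ?elmx_unit // -WU WW.
Qed.

Lemma GLmorph_refl_neq i j : i != j -> f (dilmx i (-1)) != f (dilmx j (-1)).
Proof.
move=> ij; have [k /andP[ki kj]|kij] := pickP (fun k => (k != i) && (k != j)).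
  exact: refl_neq_big ki kj.
apply: refl_neq_small => // k; rewrite -[_ || _]negbK negb_or;
  exact: negbT (kij k).
Qed.

End Nontrivial.

(** Pascal's rule and induction on [n]. This excludes sign patterns with between 2 and [n - 2]
    elements, which would yield too many independent eigenvectors. *)
Lemma ltn_bin n k : (1 < k)%N -> (k.+1 < n)%N -> (n < 'C(n, k))%N.
Proof.
elim: n k => // n IHn [//|k] k1; rewrite ltnS leq_eqVlt => /orP[/eqP<-|kn].
  rewrite binS; have -> : 'C(k.+2, k.+1) = k.+2 by rewrite -bin_sub //
    subSnn bin1.
  have : (0 < 'C(k.+2, k))%N by rewrite bin_gt0 -addn2 leq_addr.
  have [->|k2] := eqVneq k 1; first by [].
  have : 'C(k.+2, k) = 'C(k.+2, 2) by rewrite -bin_sub ?leqW // -addn2 addKn.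
  rewrite bin2 /=; nia.
rewrite binS; have := IHn k.+1 k1 kn; have : (0 < 'C(n, k))%N by rewrite
  bin_gt0; lia.
lia.
Qed.

(** The indicator tuples of the two sets contain each Boolean equally often, so one is a permutation
    of the other. *)
Lemma perm_preim_ex n (A B : {set 'I_n}) : #|A| = #|B| ->
  exists s : 'S_n, forall i, (s i \in A) = (i \in B).
Proof.
move=> AB; pose tA := [tuple i \in A | i < n]; pose tB :=
  [tuple i \in B | i < n].
have cnt (C : {set 'I_n}) b : count_mem b [tuple i \in C | i < n] =
    if b then #|C| else (n - #|C|)%N.
  rewrite /= count_map enumT; case: b.
    rewrite cardE /enum_mem size_filter; apply: eq_count => i /=.
    by rewrite eqb_id.
  have -> : (n - #|C|)%N = #|~: C| by have := cardsC C;
    rewrite card_ord => /(canRL (addKn _)) ->.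
  rewrite cardE /enum_mem size_filter; apply: eq_count => i /=.
  by rewrite inE eqbF_neg.
have /tuple_permP[s es] : perm_eq tB tA.
  by apply/allP=> b _ /=; rewrite !cnt AB.
exists s => i; have /(congr1 (fun t : n.-tuple bool =>
  tnth t i)) : tB = [tuple tnth tA (s i) | i < n].
  exact: val_inj.
by rewrite !tnth_mktuple.
Qed.

(** * Joint eigenvectors of the images of the reflections *)

Section Frame.

Variables (F : fieldType) (n : nat) (f : 'M[F]_n.+2 -> 'M[F]_n.+2).
Hypothesis charF : [pchar F] =i pred0.
Hypothesis f_morph : GLmorph f.
Hypothesis f_nontrivial :
  ~ forall A, A \in unitmx -> \det A = 1 -> f A = 1%:M.

Implicit Types (i j k l : 'I_n.+2) (x y t : F) (v : 'rV[F]_n.+2) (T : {set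
  'I_n.+2}).

Let fM A B : A \in unitmx -> B \in unitmx -> f (A *m B) = f A *m f B.
Proof. by case: f_morph => _; apply. Qed.

Let fU A : A \in unitmx -> f A \in unitmx.
Proof. by case: f_morph => + _; apply. Qed.

Let two_neq0 : (2 : F) != 0.
Proof. by have /pcharf0P -> := charF. Qed.

Let S i := f (dilmx i (-1)).

Let uD i : dilmx i (-1 : F) \in unitmx.
Proof. by rewrite dilmx_unit // oppr_eq0 oner_eq0. Qed.

Let SS i : S i *m S i = 1%:M.
Proof. by rewrite -fM // -dilmxM mulrNN mulr1 dilmx1 (GLmorph1 f_morph). Qed.

Let SC i j : S i *m S j = S j *m S i.
Proof. by rewrite -!fM // dilmxC. Qed.

Let eigen T v := forall i, v *m S i = (-1) ^+ (i \in T) *: v.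

(** Since the [S i] are commuting involutions, [S i0] acts as [- S i1] on the rows of [S i0 - S i1].
    Starting from a nonzero row, each [i] in turn either already negates [v], or [v] is replaced by
    the nonzero fixed vector [v + v *m S i]; earlier properties persist by commutation. *)
Let eigen_ex i0 i1 : i0 != i1 ->
  exists T v, [/\ v != 0, eigen T v & (i0 \in T) != (i1 \in T)].
Proof.
move=> i01.
have [k v0] : exists k, row k (S i0 - S i1) != 0.
  apply/existsP; apply: contraNT (GLmorph_refl_neq charF f_morph f_nontrivial
    i01).
  rewrite negb_exists => /forallP r0; rewrite -subr_eq0;
    apply/eqP/row_matrixP=> k.
  by rewrite row0; apply/eqP; have := r0 k; rewrite negbK.
suff [v [vN0 v01 vS]] : exists v, [/\ v != 0, v *m S i0 = - (v *m S i1)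
    & forall i, i \in enum 'I_n.+2 -> v *m S i = v \/ v *m S i = - v].
  pose T := [set i | v *m S i == - v].
  have eT i : v *m S i = (-1) ^+ (i \in T) *: v.
    rewrite inE; case: eqP => [->|neq]; first by rewrite expr1 scaleN1r.
    by case: (vS i (mem_enum _ _)) => // ->; rewrite scale1r.
  exists T, v; split=> //; apply/eqP=> T01; move: v01.
  rewrite !eT T01; set c := _ ^+ _; move/eqP; rewrite -subr_eq0 opprK -scalerDl
    -mulr2n.
  rewrite scaler_eq0 (negPf vN0) orbF -mulr_natl mulf_eq0 (negPf two_neq0) /=.
  by rewrite signr_eq0.
elim: (enum 'I_n.+2) => [|i s [v [vN0 v01 vS]]].
  exists (row k (S i0 - S i1)); split=> //.
  by rewrite -!row_mul !mulmxBl !SS -[in LHS]opprB -(SC i1) linearN.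
have [vi|vi] := eqVneq (v *m S i) (- v).
  exists v; split=> // j; rewrite inE => /orP[/eqP->|/vS //]; by right.
exists (v + v *m S i); split.
- by rewrite addrC addr_eq0.
- by rewrite !mulmxDl -!mulmxA !(SC i) !mulmxA v01 mulNmx opprD.
move=> j; rewrite inE => /orP[/eqP->|/vS vSj].
  by left; rewrite mulmxDl -mulmxA SS mulmx1 addrC.
rewrite mulmxDl -mulmxA SC mulmxA; case: vSj => ->; first by left.
by right; rewrite mulNmx opprD.
Qed.

Let eigen_orbit T v T' : v != 0 -> eigen T v -> #|T| = #|T'| ->
  exists2 v', v' != 0 & eigen T' v'.
Proof.
move=> v0 vT TT'; have [s sT] := perm_preim_ex TT'.
have us := unitmx_perm F s^-1%g.
exists (v *m f (perm_mx s^-1%g)).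
  apply: contraNneq v0 => v0.
  by rewrite -[v](mulmxK (fU us)) v0 mul0mx.
move=> i; have := perm_dilmx s^-1%g (s i) (-1 : F); rewrite permK.
move/(congr1 f); rewrite !fM // => e.
by rewrite -mulmxA e mulmxA vT sT scalemxAl.
Qed.

Let eigen_free m (Ts : 'I_m -> {set 'I_n.+2}) (V : 'M[F]_(m, n.+2)) :
    injective Ts -> (forall a, row a V != 0) ->
    (forall a, eigen (Ts a) (row a V)) ->
  row_free V.
Proof.
move=> injT V0 VT; apply: inj_row_free => u uV; apply/rowP=> a; rewrite mxE.
pose e b i : F := (-1) ^+ (i \in Ts b).
(* Each factor 1 + e a i * S i doubles or kills an eigenvector, and only row a
   survives all of them. *)
have H s : \sum_b (u 0 b * \prod_(i <- s) (1 + e a i * e b i)) *: row b V = 0.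
  elim: s => [|i s IHs].
    rewrite -[RHS]uV mulmx_sum_row; apply: eq_bigr => b _.
    by rewrite big_nil mulr1.
  have := congr1 (mulmx^~ (1%:M + e a i *: S i)) IHs; rewrite /= mul0mx => H0;
    rewrite -[RHS]H0.
  rewrite mulmx_suml; apply: eq_bigr => b _.
  rewrite -scalemxAl mulmxDr mulmx1 -scalemxAr VT -/(e b i) scalerA.
  rewrite -[X in X + _]scale1r -scalerDl scalerA.
  by rewrite big_cons; congr (_ *: _); ring.
have := H (enum 'I_n.+2); rewrite (bigD1 a) //= [X in _ + X]big1 => [|b ba];
  last first.
  have /existsP[i iab] : [exists i, (i \in Ts a) != (i \in Ts b)].
    apply: contraNT ba; rewrite negb_exists => /forallP eT;
      apply/eqP/injT/setP=> i.
    by apply/eqP; have := eT i; rewrite negbK eq_sym.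
  rewrite (bigD1_seq i) ?mem_enum ?enum_uniq //=.
  suff -> : 1 + e a i * e b i = 0 by rewrite mul0r mulr0 scale0r.
  by move: iab; rewrite /e; case: (i \in Ts a); case: (i \in Ts b) => //= _;
    ring.
rewrite addr0 => /eqP; rewrite scaler_eq0 (negPf (V0 a)) orbF mulf_eq0.
case/orP=> [/eqP -> //|]; rewrite prodf_seq_eq0 => /hasP[i _ /=].
rewrite /e -signr_addb addbb /= -[1 + 1]/(2) (negPf two_neq0); by [].
Qed.

Let eigen_card T v : v != 0 -> eigen T v -> ('C(n.+2, #|T|) <= n.+2)%N.
Proof.
move=> v0 vT; pose D := [set A : {set 'I_n.+2} | #|A| == #|T|].
have [V V0 VT] : exists2 V : 'I_#|D| -> 'rV[F]_n.+2, forall a, V a != 0 &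
    forall a, eigen (enum_val a) (V a).
  apply: (@fin_all_exists2 _ (fun=> 'rV[F]_n.+2) (fun a w =>
    w != 0) (fun a w => eigen (enum_val a) w)) => a.
  apply: (eigen_orbit v0 vT); have := enum_valP a; rewrite inE => /eqP->; by [].
have fV : row_free (\matrix_a V a).
  by apply: (@eigen_free _ (fun a => enum_val a)) => [|a|a]; rewrite ?rowK //;
     exact: enum_val_inj.
have := rank_leq_col (\matrix_a V a).
by rewrite (eqP fV) card_draws card_ord.
Qed.

Lemma GLmorph_frame : exists (R : 'M[F]_n.+2) (c : F),
  [/\ R \in unitmx, c != 0 &
      forall j, R *m f (dilmx j (-1)) = c *: (dilmx j (-1) *m R)].
Proof.
have [T [v [v0 vT T01]]] := @eigen_ex ord0 ord_max isT.
have T0 : (0 < #|T|)%N.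
  rewrite card_gt0; apply: contraNneq T01 => ->; by rewrite !inE.
have T1 : (#|T| < n.+2)%N.
  rewrite -[n.+2 in X in (_ < X)%N](card_ord n.+2) ltn_neqAle max_card andbT.
  apply: contraNneq T01 => fT; suff -> : T = [set: _] by rewrite !inE.
  by apply/eqP; rewrite eqEcard subsetT cardsT fT /= leqnn.
have Tk : #|T| = 1%N \/ #|T| = n.+1.
  have := eigen_card v0 vT; move: #|T| T0 T1 => k k0 k1 Ck.
  have [k2|k2] := leqP k 1; first by left; lia.
  have [kn|kn] := ltnP k n.+1; first by have := @ltn_bin n.+2 k k2 kn; lia.
  by right; lia.
pose b := #|T| != 1%N.
(* Patterns of size 1 are singletons, those of size [n.+1] complements of singletons. In the second
   case all signs are reversed, whence the constant [(-1) ^+ b]. *)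
pose Ts i := if b then ~: [set i] else [set i].
have cTs i : #|T| = #|Ts i|.
  rewrite /Ts /b; case: (eqVneq #|T| 1%N) Tk => [-> _|N1 [T1'|->]] /=.
  - by rewrite cards1.
  - by rewrite T1' eqxx in N1.
  by rewrite cardsCs setCK cards1 card_ord.
have [V V0 VT] : exists2 V : 'I_n.+2 -> 'rV[F]_n.+2, forall i, V i != 0 &
    forall i, eigen (Ts i) (V i).
  apply: (@fin_all_exists2 _ (fun=> 'rV[F]_n.+2) (fun i w => w != 0)
           (fun i w => eigen (Ts i) w)) => i.
  exact: eigen_orbit v0 vT (cTs i).
exists (\matrix_i V i), ((-1) ^+ b); split.
- rewrite -row_free_unit; apply: (@eigen_free _ Ts) => [i j|i|i];
  rewrite ?rowK //.
  by rewrite /Ts; case: (b) => [/setC_inj|]; exact: set1_inj.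
- by rewrite signr_eq0.
move=> j; apply/row_matrixP=> i; rewrite row_mul rowK VT.
apply/rowP=> l; rewrite [LHS]mxE [RHS]mxE [in RHS]mxE mul_elmxE !mxE /Ts.
case: (b); rewrite !inE; case: (eqVneq i j) => [->|ij];
 rewrite ?eqxx ?(eq_sym j) ?(negPf ij) /=; ring.
Qed.

End Frame.

(** * Images of the transvections *)

(** Conjugation by the reflection at [k] negates the off-diagonal entries of row and column [k], so
    each of them is its own opposite. *)
Lemma comm_refl_offdiag (F : fieldType) n (A : 'M[F]_n) k l :
    (2 : F) != 0 -> A *m dilmx k (-1) = dilmx k (-1) *m A -> k != l ->
  A k l = 0 /\ A l k = 0.
Proof.
move=> two_neq0 /matrixP cA kl; have lk : (l == k) =
  false by rewrite eq_sym (negPf kl).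
split; apply: (mulfI two_neq0); rewrite mulr0.
  have := cA k l; rewrite mulmx_elmxE mul_elmxE lk eqxx mulr0n mulr1n.
  by move/eqP; rewrite -subr_eq0 => /eqP <-; ring.
have := cA l k; rewrite mulmx_elmxE mul_elmxE lk eqxx mulr0n mulr1n.
by move/eqP; rewrite eq_sym -subr_eq0 => /eqP <-; ring.
Qed.

Lemma invmxM (F : fieldType) n (A B : 'M[F]_n.+1) :
  A \in unitmx -> B \in unitmx -> invmx (A *m B) = invmx B *m invmx A.
Proof. exact: invrM. Qed.

Section Framed.

Variables (F : fieldType) (n : nat) (g : 'M[F]_n.+2 -> 'M[F]_n.+2) (c : F).
Hypothesis two_neq0 : (2 : F) != 0.
Hypothesis three_neq0 : (3 : F) != 0.
Hypothesis g_morph : GLmorph g.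
Hypothesis g_elmx_neq1 : forall i j x, i != j -> x != 0 -> g (elmx i j x) !=
  1%:M.
Hypothesis c_neq0 : c != 0.
Hypothesis g_refl : forall j, g (dilmx j (-1)) = c *: dilmx j (-1).

Implicit Types (i j k l : 'I_n.+2) (x y t : F).

Let gM A B : A \in unitmx -> B \in unitmx -> g (A *m B) = g A *m g B.
Proof. by case: g_morph => _; apply. Qed.

Let gU A : A \in unitmx -> g A \in unitmx.
Proof. by case: g_morph => + _; apply. Qed.

Let uD i : dilmx i (-1 : F) \in unitmx.
Proof. by rewrite dilmx_unit // oppr_eq0 oner_eq0. Qed.

Let c_sq : c * c = 1.
Proof.
have := congr1 g (dilmxM (ord0 : 'I_n.+2) (-1) (-1 : F)).
rewrite gM // mulrNN mulr1 dilmx1 (GLmorph1 g_morph) g_refl -scalemxAl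
  -scalemxAr.
rewrite scalerA -dilmxM mulrNN mulr1 dilmx1 => /matrixP/(_ ord0 ord0).
by rewrite !mxE eqxx mulr1n mulr1.
Qed.

Let g_offdiag A k l : A \in unitmx -> A *m dilmx k (-1) = dilmx k (-1) *m A ->
  k != l -> g A k l = 0 /\ g A l k = 0.
Proof.
move=> uA /(congr1 g) + kl; rewrite !gM // g_refl -scalemxAl -scalemxAr => cA.
apply: comm_refl_offdiag => //; apply/(can_inj (scalerK c_neq0)); exact: cA.
Qed.

Let X_offdiag i t k l : t != 0 -> k != l -> g (dilmx i t) k l = 0.
Proof.
by move=> t0 kl; case: (@g_offdiag (dilmx i t) k l);
  rewrite ?dilmx_unit 1?dilmxC.
Qed.

Section Transvection.

Variables i j : 'I_n.+2.
Hypothesis ij : i != j.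

Let M x := g (elmx i j x).

Let uE x : elmx i j x \in unitmx.
Proof. exact: elmx_unit. Qed.

Let M_offdiag x k l : k != i -> k != j -> k != l -> M x k l = 0 /\ M x l k = 0.
Proof. by move=> ki kj kl; apply: g_offdiag; rewrite // dilmx_elmxC. Qed.

(** By [M_offdiag], rows [i] and [j] of [M x] are supported on columns [i] and [j], so the
    computation is that of 2 x 2 blocks. *)
Let mulM x (N : 'M[F]_n.+2) k l : (k == i) || (k == j) ->
  (M x *m N) k l = M x k i * N i l + M x k j * N j l.
Proof.
move=> kij; have ji : j != i by rewrite eq_sym.
rewrite mxE (bigD1 i) //= (bigD1 j) //= big1 ?addr0 // => m /andP[mi mj].
have mk : m != k by case/orP: kij => /eqP->.
by rewrite (M_offdiag x mi mj mk).2 mul0r.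
Qed.

(** [M (t * x)] is conjugate to [M x] by the image of [dilmx i t], a diagonal matrix, and such a
    conjugation preserves diagonal entries. *)
Let M_diag t x k : t != 0 -> M (t * x) k k = M x k k.
Proof.
move=> t0; have /matrixP/(_ k k) : g (dilmx i t) *m M x =
  M (t * x) *m g (dilmx i t).
  by rewrite -!gM ?dilmx_elmxl ?dilmx_unit ?uE.
rewrite !mxE (bigD1 k) //= [X in _ + X]big1 ?addr0 => [|l lk]; last first.
  by rewrite X_offdiag ?mul0r // eq_sym.
rewrite (bigD1 k) //= [X in _ + X]big1 ?addr0 => [|l lk]; last first.
  by rewrite X_offdiag ?mulr0.
rewrite mulrC => /mulIf -> //; apply: offdiag0_neq0;
  first by rewrite gU ?dilmx_unit.
by move=> *; apply: X_offdiag.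
Qed.

Let MD x y : M (x + y) = M x *m M y.
Proof. by rewrite /M elmxD // gM. Qed.

(** This entry turns sums into products, so doubling [x] squares it, whereas [M_diag] says that
    doubling leaves it unchanged. *)
Let M_other x k : k != i -> k != j -> M x k k = 1.
Proof.
move=> ki kj; have M2 y z : M (y + z) k k = M y k k * M z k k.
  rewrite MD mxE (bigD1 k) //= big1 ?addr0 // => l lk.
  by rewrite (M_offdiag y ki kj _).1 ?mul0r // eq_sym.
have M0 : M x k k != 0.
  apply/eqP=> M0; have := M2 x (- x); rewrite subrr M0 mul0r /M elmx0 (GLmorph1
    g_morph).
  by rewrite mxE eqxx => /eqP; rewrite oner_eq0.
apply: (mulfI M0); rewrite -M2 mulr1 -[x + x]mulr2n -mulr_natl.
exact: M_diag.
Qed.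

Let M_refl x : M x *m (dilmx i (-1) *m M x) = dilmx i (-1).
Proof.
have : g (dilmx i (-1)) *m M x = M (- x) *m g (dilmx i (-1)).
  by rewrite -!gM ?uE // dilmx_elmxl // mulN1r.
rewrite g_refl -scalemxAl -scalemxAr => /(can_inj (scalerK c_neq0)) ->.
by rewrite mulmxA -MD subrr /M elmx0 (GLmorph1 g_morph) mul1mx.
Qed.

Let M_block x : [/\ M x i i = 1, M x j j = 1 & M x i j * M x j i = 0].
Proof.
have ji : j != i by rewrite eq_sym.
have ii : (i == i) || (i == j) by rewrite eqxx.
have jj : (j == i) || (j == j) by rewrite eqxx orbT.
have RE k l : (M x *m (dilmx i (-1) *m M x)) k l =
  dilmx i (-1) k l by rewrite M_refl.
(* M x is conjugate to M (2 * x) = M x ^+ 2 and to M (3 * x) = M x ^+ 3 by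
   diagonal matrices, so all three have the same diagonal. *)
have := RE i i; have := RE i j; have := RE j i; have := RE j j.
rewrite !mulM // !mul_elmxE !elmxE !eqxx (negPf ij) (negPf ji) /=.
rewrite !mulr0n !mulr1n !mulr0 !addr0 !mulr1.
have D2 k : (M x *m M x) k k = M x k k.
  by rewrite -MD -[x + x]mulr2n -mulr_natl M_diag.
have D3 : (M x *m (M x *m M x)) i i = M x i i.
  have x3 : x + (x + x) = 3 * x by ring.
  by rewrite -!MD x3 M_diag.
move: (D2 i) (D2 j) D3; rewrite !mulM //.
move: (M x i i) (M x i j) (M x j i) (M x j j) => p q r s.
move=> E1 E2 E3 E4 E5 E6 E7.
have qr1 : q * r = p * p - 1 by rewrite -[LHS](addKr (p * (p + (-1 - 1) * p)))
  E7; ring.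
have sr1 : q * r = s * s - 1 by apply/eqP; rewrite eq_sym subr_eq -E4;
  apply/eqP; ring.
(* Entry [(i, j)] of [M_refl] gives [q * (s - p) = 0]; if [s] and [p] differ, then [q = 0] and both
   turn out to be 1. *)
have [sp|sp] := eqVneq s p; last first.
  have sp0 : s - p != 0 by rewrite subr_eq0.
  have q0 : q = 0 by apply: (mulIf sp0); rewrite mul0r -E6; ring.
  rewrite q0 mul0r in qr1 sr1 E1 E2; rewrite mulr0 add0r in E2;
    rewrite addr0 in E1.
  have p1 : p = 1 by rewrite -E1; apply/eqP; rewrite -subr_eq0 -qr1.
  have s1 : s = 1 by rewrite -E2; apply/eqP; rewrite -subr_eq0 -sr1.
  by rewrite p1 s1 eqxx in sp.
suff p1 : p = 1 by split; rewrite ?sp // qr1 p1 mulr1 subrr.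
(* The square leaves [p = 1] or [p = -1/2]. The latter is a block of order 3, whose square has the
   same diagonal; only the cube relation [ppp] excludes it. *)
have pp : (p - 1) * (2 * p + 1) = 0.
  have : p * p + (p * p - 1) - p = 0 by rewrite -qr1 E1 subrr.
  by move=> <-; ring.
have ppp : (p * p + 2 * p * (p * p - 1)) - p = 0.
  have : p * (p * p + q * r) + q * (r * p + s * r) - p = 0 by rewrite E3 subrr.
  by rewrite E1 sp -qr1 => <-; ring.
have [p1|p1] := eqVneq p 1 => //.
have p2 : 2 * p + 1 = 0.
  by apply: (mulfI (_ : p - 1 != 0)); rewrite ?subr_eq0 ?mulr0.
have : (2 * p + 1) * (p * p - 1) - (p - 1) = 0 by rewrite -ppp; ring.
rewrite p2 mul0r sub0r => /eqP; rewrite oppr_eq0 subr_eq0; exact: eqP.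
Qed.

Let up x := M x i j.
Let dn x := M x j i.

Lemma transvection_image x : M x = 1%:M + up x *: delta_mx i j + dn x *:
  delta_mx j i.
Proof.
have [Mi Mj _] := M_block x; have ji : j != i by rewrite eq_sym.
apply/matrixP=> k l; rewrite !mxE.
have [<-|kl] := eqVneq k l.
  have kF (a b : 'I_n.+2) : a != b -> (k == a) && (k == b) = false.
    by move=> ab; apply: contraNF ab => /andP[/eqP<- /eqP<-].
  rewrite !kF // !mulr0 !addr0; case: (eqVneq k i) => [->//|ki].
  by case: (eqVneq k j) => [->//|kj]; rewrite M_other.
rewrite add0r; case: (eqVneq k i) kl => [->|ki];
  case: (eqVneq l j) => [->|lj] //= kl;
 rewrite ?mulr0 ?mulr1 ?addr0 ?add0r.
- by rewrite (negPf ij) mulr0 addr0.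
- by rewrite (negPf ij) mulr0 (M_offdiag x _ lj (_ : l != i)).2 // eq_sym.
- by rewrite (negPf kl) mulr0 (M_offdiag x ki kl kl).1.
case: (eqVneq k j) => [kj|kj]; last by rewrite mulr0 (M_offdiag x ki kj kl).1.
case: (eqVneq l i) => [->|li] /=; first by rewrite mulr1 kj.
by rewrite mulr0 (M_offdiag x li lj (_ : l != k)).2 // eq_sym.
Qed.

(** Entry [(i, i)] of [M x *m M y = M (x + y)]. With two independent parameters, the alternative
    found at one parameter extends to all of them. *)
Lemma transvection_image_cross x y : up x * dn y = 0.
Proof.
have [xi _ _] := M_block x; have [yi _ _] := M_block y.
have [+ _ _] := M_block (x + y); rewrite MD mulM ?eqxx // xi yi mulr1.
by rewrite -[RHS]addr0 => /addrI.
Qed.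

Lemma transvection_image_neq0 x : x != 0 -> (up x != 0) || (dn x != 0).
Proof.
move=> x0; rewrite -negb_and; apply: contra (g_elmx_neq1 ij x0) =>
  /andP[/eqP u0 /eqP d0].
by rewrite -/(M x) transvection_image u0 d0 !scale0r !addr0.
Qed.

End Transvection.

Let up i j x := g (elmx i j x) i j.
Let dn i j x := g (elmx i j x) j i.
(** Orientation: whether transvections at [(i, j)] keep their position or are transposed. Testing
    the parameter 1 decides it for every [x]. *)
Let o i j := up i j 1 != 0.

Let elmx_up i j x : i != j -> o i j -> g (elmx i j x) = elmx i j (up i j x).
Proof.
move=> ij oij; rewrite transvection_image // [X in _ + X *: _](_ : _ = 0).
  by rewrite scale0r addr0.
by apply: (mulfI oij); rewrite transvection_image_cross // mulr0.
Qed.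

Let elmx_dn i j x : i != j -> ~~ o i j -> g (elmx i j x) = elmx j i (dn i j x).
Proof.
move=> ij oij; have dn1 : dn i j 1 != 0.
  by have /orP[/(negP oij)|] := transvection_image_neq0 ij (oner_neq0 F).
rewrite transvection_image // [X in _ + X *: _ + _](_ : _ = 0).
  by rewrite scale0r addr0.
by apply: (mulIf dn1); rewrite transvection_image_cross // mul0r.
Qed.

Let elmx_dn_neq0 i j x : i != j -> ~~ o i j -> x != 0 -> dn i j x != 0.
Proof.
move=> ij oij x0; apply: contraNneq (g_elmx_neq1 ij x0) => d0.
by rewrite elmx_dn // d0 elmx0.
Qed.

Let elmx_up_neq0 i j x : i != j -> o i j -> x != 0 -> up i j x != 0.
Proof.
move=> ij oij x0; apply: contraNneq (g_elmx_neq1 ij x0) => d0.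
by rewrite elmx_up // d0 elmx0.
Qed.

(** Were the orientations opposite, the image of the Weyl element and its square would be
    transvections at [(i, j)], with entry 1 at [(i, i)]; but the square must map to a matrix with -1
    there. *)
Let o_swap i j : i != j -> o i j -> o j i.
Proof.
move=> ij oij; apply: contraT => oji; have ji : j != i by rewrite eq_sym.
have := congr1 g (weylmx_sq F ij).
rewrite (gM (weylmx_unit F ij) (weylmx_unit F ij)) (gM (uD i) (uD j)) !g_refl
  -scalemxAl -scalemxAr scalerA c_sq scale1r.
rewrite /weylmx !gM ?unitmx_mul ?elmx_unit // (elmx_up _ ij) //
  (elmx_dn _ ji) //.
rewrite -!elmxD // => /matrixP/(_ i i).
rewrite mul_elmx !mxE !eqxx (negPf ij) /= !mulr1n !mulr0 !addr0 mulr1.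
move/eqP; rewrite -subr_eq0 => /eqP e; case/eqP: two_neq0; rewrite -e; ring.
Qed.

(** [elmx i j 1] and [elmx i k 1] commute, while images at positions [(i, j)] and [(k, i)] would
    differ in entry [(k, j)] of their two products. *)
Let o_row i j k : i != j -> i != k -> o i j -> o i k.
Proof.
have [-> //|jk] := eqVneq j k => ij ik oij; apply: contraT => oik.
have ki : k != i by rewrite eq_sym. have ji : j != i by rewrite eq_sym.
have : elmx i j 1 *m elmx i k 1 = elmx i k 1 *m elmx i j 1 :> 'M[F]_n.+2.
  by rewrite !mul_elmx (negPf ki) (negPf ji) !mulr0 !scale0r !addr0 addrAC.
move/(congr1 g); rewrite !gM ?elmx_unit // elmx_up // elmx_dn // !mul_elmx.
rewrite eqxx mulr1 (negPf jk) mulr0 scale0r addr0 [1%:M + _ + _]addrAC.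
rewrite -[LHS]addr0 => /addrI/matrixP/(_ k j); rewrite !mxE !eqxx mulr1 =>
  /esym/eqP.
by rewrite mulf_eq0 (negPf (elmx_dn_neq0 ik oik (oner_neq0 F))) (negPf oij).
Qed.

Let o_const i j : i != j -> o i j = o ord0 ord_max.
Proof.
have o_swapE k l : k != l -> o k l = o l k.
  by move=> kl; apply/idP/idP; apply: o_swap => //; rewrite eq_sym.
have o_rowE k l m : k != l -> k != m -> o k l = o k m.
  by move=> kl km; apply/idP/idP; apply: o_row.
have [-> ij|i0 ij] := eqVneq i ord0; first exact: o_rowE.
by rewrite (o_rowE i j ord0) // o_swapE //; apply: o_rowE; rewrite // eq_sym.
Qed.

Lemma framed_GLmorph :
  exists (psi : {rmorphism F -> F}) (mu : F -> F) (Q : 'M[F]_n.+2),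
    [/\ Q \in unitmx, forall x, x != 0 -> mu x != 0,
        forall x y, x != 0 -> y != 0 -> mu (x * y) = mu x * mu y
      & (forall A, A \in unitmx ->
           g A = mu (\det A) *: (Q *m map_mx psi A *m invmx Q))
        \/ (forall A, A \in unitmx ->
           g A = mu (\det A) *: (Q *m (invmx (map_mx psi A))^T *m invmx Q))].
Proof.
have [oT|oF] := boolP (o ord0 ord_max).
  have [|||psi [mu [Q [uQ mu0 muM gE]]]] := @GLmorph_rigidity F n g up.
  - exact: g_morph.
  - by move=> i j x ij; apply: elmx_up; rewrite ?o_const.
  - by move=> i j x ij; apply: elmx_up_neq0; rewrite ?o_const.
  by exists psi, mu, Q; split=> //; left.
(* The inverse transpose puts every transposed image back in position; the inverse accounts for the
   sign in [- dn i j x]. *)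
pose h A := (invmx (g A))^T.
have hg A : A \in unitmx -> g A = invmx (h A)^T by move=> uA;
  rewrite trmxK invmxK.
have h_morph : GLmorph h.
  split=> [A uA|A B uA uB]; first by rewrite unitmx_tr unitmx_inv gU.
  by rewrite /h gM // invmxM ?gU // trmx_mul.
have [|||psi [mu [Q [uQ mu0 muM hE]]]] := @GLmorph_rigidity F n h (fun i j x =>
  - dn i j x).
- exact: h_morph.
- move=> i j x ij; rewrite /h elmx_dn ?o_const //.
  have ji : j != i by rewrite eq_sym.
  rewrite -[RHS]tr_elmx; congr trmx; apply: (can_inj (mulKmx (elmx_unit (dn i j
    x) ji))).
  by rewrite mulmxV ?elmx_unit // -elmxD // subrr elmx0.
- by move=> i j x ij x0; rewrite oppr_eq0 elmx_dn_neq0 ?o_const.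
exists psi, (fun x => (mu x)^-1), (invmx Q)^T; split.
- by rewrite unitmx_tr unitmx_inv.
- by move=> x x0; rewrite invr_eq0 mu0.
- by move=> x y x0 y0; rewrite muM // invfM.
right=> A uA; rewrite hg // hE //.
have uP : map_mx psi A \in unitmx by rewrite map_unitmx.
rewrite linearZ /= invmxZ; last first.
  rewrite unitmxZ ?unitmx_tr ?unitmx_mul ?unitmx_inv ?uQ ?uP //.
  by rewrite unitfE mu0 // -unitfE -unitmxE.
rewrite !trmx_mul !invmxM ?unitmx_mul ?unitmx_tr ?unitmx_inv ?uQ ?uP //.
by rewrite !trmx_inv.
Qed.

End Framed.

(** * Undoing the change of frame, and return to the group [GL n F] *)

Lemma nontrivial_GLmorph (F : fieldType) n (f : 'M[F]_n.+2 -> 'M[F]_n.+2) :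
    [pchar F] =i pred0 -> GLmorph f ->
    ~ (forall A, A \in unitmx -> \det A = 1 -> f A = 1%:M) ->
  exists (psi : {rmorphism F -> F}) (mu : F -> F) (Q : 'M[F]_n.+2),
    [/\ Q \in unitmx, forall x, x != 0 -> mu x != 0,
        forall x y, x != 0 -> y != 0 -> mu (x * y) = mu x * mu y
      & (forall A, A \in unitmx ->
           f A = mu (\det A) *: (Q *m map_mx psi A *m invmx Q))
        \/ (forall A, A \in unitmx ->
           f A = mu (\det A) *: (Q *m (invmx (map_mx psi A))^T *m invmx Q))].
Proof.
move=> charF f_morph f_nontriv.
have [R [c [uR c0 Rrefl]]] := GLmorph_frame charF f_morph f_nontriv.
have [fU fM] := f_morph.
pose g A := R *m f A *m invmx R.
have fg A : f A = invmx R *m g A *m R by rewrite /g !mulmxA mulVmx //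
  mul1mx mulmxKV.
have g_morph : GLmorph g.
  split=> [A uA|A B uA uB]; first by rewrite !unitmx_mul uR fU ?unitmx_inv.
  by rewrite /g fM // !mulmxA mulmxKV.
have natF m : (m.+1%:R : F) != 0 by have /pcharf0P -> := charF.
have g_neq1 i j x : i != j -> x != 0 -> g (elmx i j x) != 1%:M.
  move=> ij x0; apply: contra (GLmorph_elmx_neq1 f_morph f_nontriv ij x0) =>
    /eqP g1.
  by rewrite fg g1 mulmx1 mulVmx.
have g_refl j : g (dilmx j (-1)) = c *: dilmx j (-1).
  by rewrite /g Rrefl -scalemxAl mulmxK.
have [psi [mu [Q [uQ mu0 muM gE]]]] :=
  framed_GLmorph (natF 1) (natF 2) g_morph g_neq1 c0 g_refl.
exists psi, mu, (invmx R *m Q); split=> //.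
  by rewrite unitmx_mul unitmx_inv uR.
by case: gE => gE; [left|right] => A uA; rewrite fg gE // -scalemxAr -scalemxAl;
   rewrite invmxM ?unitmx_inv // invmxK !mulmxA.
Qed.

Lemma multiplicative_Fstar_ex (F : fieldType) (mu : F -> F) :
    (forall x, x != 0 -> mu x != 0) ->
    (forall x y, x != 0 -> y != 0 -> mu (x * y) = mu x * mu y) ->
  exists lambda : {multiplicative Fstar F -> Fstar F},
    forall a, val (lambda a) = mu (val a).
Proof.
move=> mu0 muM; pose l (a : Fstar F) := MkFstar (mu0 _ (Fstar_neq0 a)).
have lM : {morph l : a b / (a * b)%g}.
  by move=> a b; apply: val_inj; rewrite /= muM ?Fstar_neq0.
pose m := isMultiplicative.Build (Fstar F) (Fstar F) l lM.
by exists (HB.pack l m : {multiplicative Fstar F -> Fstar F}).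
Qed.

Theorem theorem3p1 (F : fieldType) (n : nat)
    (charF : [pchar F] =i pred0) (n_gt0 : (0 < n)%N)
    (Phi : {multiplicative GL n F -> GL n F})
    (Phi_nontrivial : ~ {subset SL n F <= [preim Phi of pred1 1%g]}) :
  exists (lambda : {multiplicative Fstar F -> Fstar F})
         (Phi1 Phi2 : GL n F -> GL n F),
    [/\ basic_composition Phi1,
        basic_composition Phi2
      & forall A : GL n F,
          Phi A = scaleGL (lambda (detGL (Phi1 A))) (Phi2 A)].
Proof.
have Phi_1 : Phi 1%g = 1%g.
  by apply: (mulgI (Phi 1%g)); rewrite -gmulfM !mulg1.
(* In size 1 the group SL is trivial, which contradicts non-triviality. *)
case: n => [//|[|n]] in n_gt0 Phi Phi_nontrivial Phi_1 *.
  case: Phi_nontrivial => A /eqP dA; rewrite inE /=; apply/eqP.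
  suff -> : A = 1%g by [].
  by apply: val_inj; rewrite /= [LHS]mx11_scalar -det_mx11 dA.
(* Singular matrices get the default value 1; [f] is only evaluated meaningfully on invertible
   ones. *)
pose toGL (A : 'M[F]_n.+2) : GL n.+2 F := insubd (1%g : GL n.+2 F) A.
pose f (A : 'M[F]_n.+2) : 'M[F]_n.+2 := Phi (toGL A).
have toGLK A : A \in unitmx -> GLmx (toGL A) = A by exact: (insubdK (1%g : GL
  n.+2 F)).
have fE (A : GL n.+2 F) : GLmx (Phi A) = f A.
  by congr (GLmx (Phi _)); apply: val_inj; rewrite /= toGLK ?GLmx_unit.
have f_morph : GLmorph f.
  split=> [A _|A B uA uB]; first exact: GLmx_unit.
  rewrite /f -[RHS]/(GLmx (Phi (toGL A) * Phi (toGL B))%g) -gmulfM.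
  congr (GLmx (Phi _)); apply: val_inj; rewrite [LHS]toGLK ?unitmx_mul ?uA //.
  by rewrite -[RHS]/(GLmx (toGL A) *m GLmx (toGL B)) !toGLK.
have f_nontriv : ~ forall A, A \in unitmx -> \det A = 1 -> f A = 1%:M.
  move=> f1; apply: Phi_nontrivial => A /eqP dA; rewrite inE /=.
  by apply/eqP/val_inj; rewrite /= fE f1 ?GLmx_unit.
have [psi [mu [Q [uQ mu0 muM fphi]]]] := nontrivial_GLmorph charF f_morph
  f_nontriv.
(* [conjGL R] puts the inverse on the left, so [R] is the inverse of [Q]. *)
pose R : GL n.+2 F := (MkGL uQ)^-1%g.
have det1E A : detGL (conjGL 1 A) = detGL A by rewrite /conjGL invg1 mul1g
  mulg1.
case: fphi => fphi.
  have [lambda lambdaE] := multiplicative_Fstar_ex mu0 muM.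
  exists lambda, (conjGL 1%g), (conjGL R \o mapGL psi); split.
  - by do 2!constructor.
  - by apply: CompComp; apply: CompBasic; constructor.
  move=> A; apply: val_inj; rewrite /= fE fphi ?GLmx_unit //.
  by rewrite lambdaE det1E invmxK.
(* The transposed adjugate is the inverse transpose times the determinant, here [psi (\det A)];
   dividing [mu] by [psi] compensates for this factor. *)
pose nu x := mu x / psi x.
have nu0 x : x != 0 -> nu x != 0.
  by move=> x0; rewrite mulf_neq0 ?mu0 // invr_eq0 fmorph_eq0.
have nuM x y : x != 0 -> y != 0 -> nu (x * y) = nu x * nu y.
  by move=> x0 y0; rewrite /nu muM // rmorphM invfM mulrACA.
have [lambda lambdaE] := multiplicative_Fstar_ex nu0 nuM.
exists lambda, (conjGL 1%g), (conjGL R \o (@adjTGL _ F \o mapGL psi)); split.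
- by do 2!constructor.
- by do 2!(apply: CompComp; first by apply: CompBasic; constructor);
     apply: CompBasic; constructor.
move=> A; apply: val_inj; rewrite /= fE fphi ?GLmx_unit //.
rewrite lambdaE det1E invmxK -[(\adj _)^T]/(GLmx (adjTGL (mapGL psi A)))
  adjTGLE.
rewrite /= det_map_mx.
rewrite -scalemxAr -scalemxAl scalerA /nu divfK //.
by rewrite fmorph_eq0 detGL_subproof.
Qed.
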